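(* Let $p$ be an odd prime. For every nonempty $S \subseteq \mathbf{Z}/p$, $$\mathrm{diam}_+^{H_p}\bigl(\mathbf{C}[\mathbf{Z}/p], U_S\bigr) = \min\bigl\{|T| \bigm| T \subseteq \mathbf{Z}/p,\ S + T = \mathbf{Z}/p\bigr\},$$ the least number of translates of $S$ needed to cover $\mathbf{Z}/p$, against the trivial lower bound $\lceil \dim \mathbf{C}[\mathbf{Z}/p]/\dim U_S\rceil = \lceil p/|S| \rceil$.
   Context: For an odd prime $p$ let $\omega = e^{2\pi i/p}$ and let $V = \mathbf{C}[\mathbf{Z}/p]$ have basis $(e_j)_{j \in \mathbf{Z}/p}$. Define operators $X e_j = e_{j+1}$ and $Z e_j = \omega^j e_j$. The Heisenberg group is $H_p = \langle X, Z\rangle \leq \mathrm{GL}(V)$. For a nonempty subset $S \subseteq \mathbf{Z}/p$, $U_S = \langle e_s \mid s \in S\rangle$ is the coordinate subspace on $S$. Here $S+T = \{s+t \mid s\in S, t\in T\}$. For a group $H$ acting linearly on a finite-dimensional complex vector space $V$ and a nonzero subspace $U \leq V$, the group-additive diameter is $$\mathrm{diam}_+^{H}(V,U) = \min\{ m \mid g_1\cdot U + \dots + g_m\cdot U = V \text{ for some } g_1,\dots,g_m \in H\}.$$ *)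

(* Defs.v *)
From HB Require Import structures.
From mathcomp Require Import all_boot all_order all_algebra.
From mathcomp Require Import boolp classical_sets reals trigo complex.

Set Implicit Arguments.
Unset Strict Implicit.
Unset Printing Implicit Defensive.

Import Order.TTheory GRing.Theory Num.Theory.
Local Open Scope ring_scope.
Local Open Scope complex_scope.

Section GeneralLinearGroup.
Variables (K : fieldType) (V : vectType K).

(* V has finite dimension, so injective endomorphisms are invertible. *)
Record GL := MkGL { GLfun :> 'End(V); GL_inj : lker GLfun == 0%VS }.

HB.instance Definition _ := [isSub for GLfun].
HB.instance Definition _ := [Choice of GL by <:].

Fact GL_mul_inj (f g : GL) : lker (f \o g)%VF == 0%VS.
Proof.
apply/lker0P => u v; rewrite !comp_lfunE.
by move=> /(lker0P (GL_inj f)) /(lker0P (GL_inj g)).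
Qed.

Fact GL_one_inj : lker (\1%VF : 'End(V)) == 0%VS.
Proof. by apply/lker0P => u v; rewrite !id_lfunE. Qed.

Fact GL_inv_inj (f : GL) : lker (f^-1)%VF == 0%VS.
Proof. by apply/lker0P/(can_inj (lker0_lfunVK (GL_inj f))). Qed.

Definition GL_mul (f g : GL) := MkGL (GL_mul_inj f g).
Definition GL_one := MkGL GL_one_inj.
Definition GL_inv (f : GL) := MkGL (GL_inv_inj f).

Fact GL_mulA : associative GL_mul.
Proof. by move=> f g h; apply/val_inj/comp_lfunA. Qed.
Fact GL_mul1g : left_id GL_one GL_mul.
Proof. by move=> f; apply/val_inj/comp_lfun1l. Qed.
Fact GL_mulg1 : right_id GL_one GL_mul.
Proof. by move=> f; apply/val_inj/comp_lfun1r. Qed.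
Fact GL_mulVg : left_inverse GL_one GL_inv GL_mul.
Proof. by move=> f; apply/val_inj/lker0_compVf/GL_inj. Qed.
Fact GL_mulgV : right_inverse GL_one GL_inv GL_mul.
Proof. by move=> f; apply/val_inj/lker0_compfV/GL_inj. Qed.

HB.instance Definition _ :=
  isGroup.Build GL GL_mulA GL_mul1g GL_mulg1 GL_mulVg GL_mulgV.

End GeneralLinearGroup.

Section GeneratedSubgroup.
Variables (G : groupType) (A : set G).

Definition gen_group : set G :=
  smallest (fun B : set G => group_closed [in B]) A.

Definition in_gen_group : pred G := [in gen_group].

Fact gen_group_closed : group_closed in_gen_group.
Proof.
split=> [|x y]; rewrite !inE.
  by move=> B [[B1 _] _]; rewrite -[B _]inE.
move=> Ax Ay B BA; have [[_ Bdiv] _] := BA.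
by have := Bdiv x y; rewrite !inE; apply; [apply: Ax | apply: Ay].
Qed.

Record gen_type := GenType { gen_val :> G; _ : in_gen_group gen_val }.

HB.instance Definition _ := [isSub for gen_val].
HB.instance Definition _ := [Choice of gen_type by <:].
HB.instance Definition _ :=
  SubChoice_isSubGroup.Build G in_gen_group gen_type gen_group_closed.

Fact gen_valM : {morph gen_val : x y / (x * y)%g}.
Proof. by move=> x y; exact: (valM x y). Qed.

Fact gen_val1 : gen_val 1%g = 1%g.
Proof. exact: (val1 gen_type). Qed.

HB.instance Definition _ := isMultiplicative.Build gen_type G gen_val gen_valM.
HB.instance Definition _ :=
  Multiplicative_isUMagmaMorphism.Build gen_type G gen_val gen_val1.

End GeneratedSubgroup.

Section Diameter.
Variables (K : fieldType) (V : vectType K) (H : groupType).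
(* a morphism H -> GL(V), i.e. a linear action of H on V *)
Variable rho : UMagmaMorphism.type H (GL V).
Variable U : {vspace V}.

Definition translates_span (m : nat) : Prop :=
  exists g : 'I_m -> H, (\sum_(i < m) GLfun (rho (g i)) @: U)%VS = fullv.

(* None when no finite family of translates of U spans V *)
Definition diam_plus : option nat :=
  if pselect (exists m, `[< translates_span m >]) is left ex
  then Some (ex_minn ex) else None.

End Diameter.

Section Heisenberg.
Variables (R : realType) (p : nat).

(* e^(2 i pi / p) *)
Definition omega : R[i] :=
  cos (2 * pi / p%:R) +i* sin (2 * pi / p%:R).

(* 'Z_p is Z/p only for 1 < p. *)
Definition CZp := {ffun 'Z_p -> (R[i])^o}.
HB.instance Definition _ := Vector.on CZp.

Definition basis_vec (j : 'Z_p) : CZp := [ffun k => (k == j)%:R].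

(* the linear operator mapping basis_vec j to F j *)
Definition on_basis (F : 'Z_p -> CZp) : 'End(CZp) :=
  linfun (fun v : CZp => \sum_j v j *: F j).

Definition X_op : 'End(CZp) := on_basis (fun j => basis_vec (j + 1)).
Definition Z_op : 'End(CZp) := on_basis (fun j => omega ^+ j *: basis_vec j).

Lemma on_basisE F v : on_basis F v = \sum_j v j *: F j.
Proof.
pose f (v : CZp) := \sum_j v j *: F j.
have fZ : scalable f.
  move=> a u; rewrite /f scaler_sumr; apply: eq_bigr => j _.
  by rewrite ffunE scalerA.
have fD : {morph f : u w / u + w}.
  move=> u w; rewrite /f -big_split; apply: eq_bigr => j _.
  by rewrite ffunE scalerDl.
pose fM := GRing.isSemilinear.Build _ _ _ _ f (conj fZ fD).
pose fL : {linear CZp -> CZp} := HB.pack f fM.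
exact: (lfunE fL).
Qed.

Lemma on_basis_e F j : on_basis F (basis_vec j) = F j.
Proof.
rewrite on_basisE (bigD1 j) //= big1 ?addr0 => [|k /negbTE kj].
  by rewrite ffunE eqxx scale1r.
by rewrite ffunE kj scale0r.
Qed.

Lemma omega_neq0 : omega != 0.
Proof.
rewrite eq_complex /=; apply/negP => /andP[/eqP c0 /eqP s0].
have := cos2Dsin2 (2 * pi / p%:R : R).
by rewrite c0 s0 expr0n addr0 => /eqP; rewrite eq_sym oner_eq0.
Qed.

Lemma X_opE v k : X_op v k = v (k - 1).
Proof.
rewrite on_basisE sum_ffunE (bigD1 (k - 1)) //= big1 => [|j jk].
  by rewrite !ffunE subrK eqxx addr0 /GRing.scale /= mulr1.
by rewrite !ffunE -subr_eq eq_sym (negbTE jk) scaler0.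
Qed.

Lemma Z_opE v k : Z_op v k = omega ^+ k * v k.
Proof.
rewrite on_basisE sum_ffunE (bigD1 k) //= big1 => [|j jk].
  by rewrite !ffunE eqxx addr0 /GRing.scale /= mulr1 mulrC.
by rewrite !ffunE eq_sym (negbTE jk) !scaler0.
Qed.

Fact X_op_inj : lker X_op == 0%VS.
Proof.
apply/lker0P => u v /ffunP uv; apply/ffunP => k.
by have := uv (k + 1); rewrite !X_opE addrK.
Qed.

Fact Z_op_inj : lker Z_op == 0%VS.
Proof.
apply/lker0P => u v /ffunP uv; apply/ffunP => k.
by have := uv k; rewrite !Z_opE => /mulfI; apply; rewrite expf_neq0 ?omega_neq0.
Qed.

Definition X_GL : GL CZp := MkGL X_op_inj.
Definition Z_GL : GL CZp := MkGL Z_op_inj.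

Definition heisenberg : groupType := gen_type [set X_GL; Z_GL]%classic.

Definition heisenberg_action : UMagmaMorphism.type heisenberg (GL CZp) :=
  UMagmaMorphism.clone _ _ (@gen_val _ [set X_GL; Z_GL]%classic) _.

Definition coord_subspace (S : {set 'Z_p}) : {vspace CZp} :=
  <<[seq basis_vec s | s in S]>>%VS.

End Heisenberg.

Section Covering.
Variable p : nat.

Definition sumset (S T : {set 'Z_p}) : {set 'Z_p} :=
  [set s + t | s in S, t in T].

(* the default setT is admissible as soon as S is nonempty (sumsetT) *)
Definition covering_number (S : {set 'Z_p}) : nat :=
  #|[arg min_(T < [set: 'Z_p] | sumset S T == [set: 'Z_p]) #|T|]|.

Lemma sumsetT (S : {set 'Z_p}) : S != finset.set0 -> sumset S [set: 'Z_p] = [set: 'Z_p].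
Proof.
case/finset.set0Pn => s sS; apply/finset.setP => x; rewrite inE.
by apply/imset2P; exists s (x - s); rewrite ?inE // addrC subrK.
Qed.

End Covering.

(* the ceiling of the exact quotient m / n in rat *)
Definition ceil_div (m n : nat) : int := Num.ceil (m%:R / n%:R : rat).

(* Main.v *)
Require Import Defs.
From mathcomp Require Import all_boot all_order all_algebra.
From mathcomp Require Import reals complex.
From mathcomp Require boolp classical_sets.

(** The generators of the Heisenberg group are monomial: X moves the support of
    a vector by 1 and Z, being diagonal with nonzero entries, leaves it in place.
    The operators that translate every support by a common amount form a group,
    so each element of the Heisenberg group does so by some a
    ([heisenberg_shifts]), every a being reached by a power of X
    ([shifts_heisenberg]). A coordinate subspace is cut out by a condition on
    supports, hence a group element with translation a maps U_S onto U_(S + a)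
    ([shifts_support_coord]): the group acts on coordinate subspaces only
    through translations of index sets.

    Sums of coordinate subspaces correspond to unions of index sets
    ([coord_subspace_bigcup]), and U_S is the whole space exactly when S is all
    of Z/p. Therefore m translates of U_S can span precisely when S + T = Z/p
    for a T listed by m elements ([translates_span_sumset]), and the two minima
    agree. The lower bound is the count p = |S + T| <= |S| |T|, together with
    dim U_S = |S|. *)

Import GRing.Theory Num.Theory.
Local Open Scope ring_scope.

Section CoordinateSubspaces.
Context {R : realType} {p : nat}.
Implicit Types (S T : {set 'Z_p}) (v : CZp R p) (k : 'Z_p).

Lemma basis_decomposition v : v = \sum_k v k *: basis_vec R k.
Proof.
apply/ffunP => j; rewrite sum_ffunE (bigD1 j) //= big1 => [|k kj].
  by rewrite !ffunE eqxx addr0 /GRing.scale /= mulr1.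
by rewrite !ffunE eq_sym (negbTE kj) scaler0.
Qed.

Lemma memv_coord_subspace S v :
  reflect (forall k, k \notin S -> v k = 0) (v \in coord_subspace R S).
Proof.
apply: (iffP idP) => [vS k kS | v0].
  rewrite (coord_span (X := in_tuple _) vS) sum_ffunE big1 // => i _.
  rewrite ffunE.
  have /imageP[s sS ->] : (in_tuple [seq basis_vec R s | s in S])`_i
      \in [seq basis_vec R s | s in S] by rewrite mem_nth.
  by rewrite ffunE; case: eqP kS sS => [->/negP//|_ _ _]; rewrite scaler0.
rewrite (basis_decomposition v); apply: memv_suml => k _.
have [kS|/v0->] := boolP (k \in S); last by rewrite scale0r mem0v.
by apply/memvZ/memv_span/imageP; exists k.
Qed.

Lemma memv_basis_vec S k : (basis_vec R k \in coord_subspace R S) = (k \in S).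
Proof.
apply/memv_coord_subspace/idP => [h|kS j jS].
  by apply/negPn/negP => /h /eqP; rewrite ffunE eqxx oner_eq0.
by rewrite ffunE; case: eqP jS => [->|//]; rewrite kS.
Qed.

Lemma coord_subspace0 : coord_subspace R (set0 : {set 'Z_p}) = 0%VS.
Proof. by rewrite /coord_subspace /image_mem enum_set0 span_nil. Qed.

Lemma coord_subspaceU S T :
  coord_subspace R (S :|: T) = (coord_subspace R S + coord_subspace R T)%VS.
Proof.
rewrite -span_cat; apply: eq_span => v; rewrite mem_cat.
apply/imageP/orP => [[s]|[] /imageP[s sS ->]].
- by rewrite inE => /orP[] sS ->; [left|right]; apply/imageP; exists s.
- by exists s => //; rewrite inE sS.
- by exists s => //; rewrite inE sS orbT.
Qed.

Lemma coord_subspace_bigcup (I : finType) (F : I -> {set 'Z_p}) :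
  coord_subspace R (\bigcup_i F i) = (\sum_i coord_subspace R (F i))%VS.
Proof. exact: (big_morph _ coord_subspaceU coord_subspace0). Qed.

Lemma coord_subspace_full S : coord_subspace R S = fullv <-> S = [set: 'Z_p].
Proof.
split=> [Sfull|->]; first by apply/setP => k; rewrite -memv_basis_vec Sfull memvf inE.
apply/vspaceP => v; rewrite memvf; apply/memv_coord_subspace => k.
by rewrite inE.
Qed.

Lemma dim_CZp : \dim {:CZp R p} = #|'Z_p|.
Proof. by rewrite dimvf /dim /= muln1. Qed.

(** The spanning families bound the dimensions of U_S and of U_(~: S) by the
    numbers of their indices. These two spaces add up to the whole space, whose
    dimension is the sum of the two bounds, so both bounds are attained. *)
Lemma dim_coord_subspace S : \dim (coord_subspace R S) = #|S|.
Proof.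
have ub A : (\dim (coord_subspace R A) <= #|A|)%N.
  by rewrite (leq_trans (dim_span _)) // size_image.
apply/eqP; rewrite eqn_leq ub /= -(leq_add2r #|~: S|) cardsC -dim_CZp.
rewrite -(proj2 (coord_subspace_full _) erefl) -(setUCr S) coord_subspaceU.
by rewrite (leq_trans (dimv_add_leqif _ _)) // leq_add2l ub.
Qed.

End CoordinateSubspaces.

Section HeisenbergShifts.
Context {R : realType} {p : nat}.
Implicit Types (S T : {set 'Z_p}) (v : CZp R p) (k a b : 'Z_p).

(** Recording only the vanishing of coordinates forgets the nonzero scalars of a
    monomial operator; this is all that matters for its action on coordinate
    subspaces, and it spares any computation with roots of unity. *)
Definition shifts_support (g : GL (CZp R p)) a :=
  forall v k, (g v k == 0) = (v (k - a) == 0).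

Lemma shifts_support1 : shifts_support 1%g 0.
Proof. by move=> v k; rewrite id_lfunE subr0. Qed.

Lemma shifts_supportM g h a b :
  shifts_support g a -> shifts_support h b -> shifts_support (g * h)%g (a + b).
Proof.
by move=> ga hb v k; rewrite comp_lfunE ga hb -addrA -opprD.
Qed.

Lemma GLKV {K : fieldType} {V : vectType K} (g : GL V) (v : V) : g ((g^-1)%g v) = v.
Proof. by rewrite -comp_lfunE lker0_compfV ?GL_inj ?id_lfunE. Qed.

Lemma shifts_supportV g a :
  shifts_support g a -> shifts_support (g^-1)%g (- a).
Proof.
by move=> ga v k; rewrite -[in RHS](GLKV g v) ga opprK addrK.
Qed.

Lemma shifts_support_X : shifts_support (X_GL R p) 1.
Proof. by move=> v k; rewrite X_opE. Qed.

Lemma shifts_support_Z : shifts_support (Z_GL R p) 0.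
Proof.
by move=> v k; rewrite Z_opE subr0 mulf_eq0 expf_eq0 (negbTE (omega_neq0 _ _)) andbF.
Qed.

(** Both inclusions come from the support of a preimage: the image of a vector
    supported in S is supported in S + a, and the inverse of g translates supports
    back by - a. *)
Lemma shifts_support_coord g a S : shifts_support g a ->
  (GLfun g @: coord_subspace R S)%VS = coord_subspace R [set s + a | s in S].
Proof.
move=> ga; have subK k : (k \in [set s + a | s in S]) = (k - a \in S).
  apply/imsetP/idP => [[s sS ->]|kS]; first by rewrite addrK.
  by exists (k - a); rewrite ?subrK.
apply/vspaceP => w; apply/memv_imgP/memv_coord_subspace => [[v vS ->] k|w0].
  by rewrite subK => /(memv_coord_subspace _ _ vS)/eqP; rewrite -ga => /eqP.
exists ((g^-1)%g w); last by rewrite GLKV.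
apply/memv_coord_subspace => k kS; apply/eqP.
by rewrite (shifts_supportV _ _ ga) opprK w0 // subK addrK.
Qed.

(** The operators that translate supports form a subgroup containing both
    generators, hence containing the smallest such subgroup. *)
Lemma heisenberg_shifts (h : heisenberg R p) :
  exists a, shifts_support (heisenberg_action R p h) a.
Proof.
pose B : classical_sets.set (GL (CZp R p)) := fun g => exists a, shifts_support g a.
case: h => g /= /classical_sets.set_mem gen_g; apply: (gen_g B).
split; last first.
  by move=> _ [->|->]; [exists 1; exact: shifts_support_X
                       | exists 0; exact: shifts_support_Z].
split=> [|x y]; rewrite !classical_sets.inE; first by exists 0; exact: shifts_support1.
by move=> [a xa] [b yb]; exists (a - b); apply/shifts_supportM/shifts_supportV.
Qed.

Lemma shifts_heisenberg a :
  exists h : heisenberg R p, shifts_support (heisenberg_action R p h) a.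
Proof.
have XH : in_gen_group (fun g => g = X_GL R p \/ g = Z_GL R p) (X_GL R p).
  by apply/classical_sets.mem_set => B [_]; apply; left.
pose x : heisenberg R p := GenType XH.
have xn n : exists h : heisenberg R p,
    shifts_support (heisenberg_action R p h) n%:R.
  elim: n => [|n [h hn]]; first by exists 1%g; exact: shifts_support1.
  exists (x * h)%g; rewrite mulrS.
  exact: (shifts_supportM _ _ _ _ shifts_support_X hn).
by have [h] := xn a; rewrite natr_Zp; exists h.
Qed.

End HeisenbergShifts.

Section Diameter.
Context {R : realType} {p : nat}.
Implicit Types (S T : {set 'Z_p}).

Lemma sumset_bigcup (I : finType) S (a : I -> 'Z_p) :
  \bigcup_i [set s + a i | s in S] = sumset S [set a i | i in I].
Proof.
apply/setP => x; apply/bigcupP/imset2P => [[i _ /imsetP[s sS ->]]|].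
  by exists s (a i); rewrite ?imset_f.
by move=> [s _ sS /imsetP[i _ ->] ->]; exists i => //; apply: imset_f.
Qed.

(** The translations need not be distinct: a family a : 'I_m -> Z/p covers as
    well as its image, of cardinal at most m. Keeping the family makes m match
    the length of the spanning sum, and the passage to cardinals is left to the
    comparison of minima. *)
Lemma translates_span_sumset S m :
  translates_span (heisenberg_action R p) (coord_subspace R S) m <->
  exists a : 'I_m -> 'Z_p, sumset S [set a i | i in 'I_m] = [set: 'Z_p].
Proof.
have sumE (g : 'I_m -> heisenberg R p) (a : 'I_m -> 'Z_p) :
    (forall i, shifts_support (heisenberg_action R p (g i)) (a i)) ->
  (\sum_(i < m) GLfun (heisenberg_action R p (g i)) @: coord_subspace R S)%VS
    = coord_subspace R (sumset S [set a i | i in 'I_m]).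
  move=> ga; rewrite -sumset_bigcup coord_subspace_bigcup.
  by apply: eq_bigr => i _; apply: shifts_support_coord.
split=> [[g gS]|[a aS]].
  have [a ga] := boolp.choice (fun i => heisenberg_shifts (g i)).
  by exists a; apply/(coord_subspace_full (R := R)); rewrite -(sumE g).
have [g ga] := boolp.choice (fun i => shifts_heisenberg (R := R) (a i)).
by exists g; rewrite (sumE g a) // aS; apply/coord_subspace_full.
Qed.

Lemma covering_numberP S : S != set0 ->
  exists2 T, sumset S T = setT & covering_number S = #|T|.
Proof.
move=> S0; rewrite /covering_number; case: arg_minnP => [|T /eqP ST _].
  by rewrite sumsetT.
by exists T.
Qed.

Lemma covering_number_min S T : S != set0 ->
  sumset S T = setT -> (covering_number S <= #|T|)%N.
Proof.
move=> S0 ST; rewrite /covering_number; case: arg_minnP => [|U _]; last first.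
  by apply; rewrite ST.
by rewrite sumsetT.
Qed.

Lemma diam_plus_coord_subspace S : S != set0 ->
  diam_plus (heisenberg_action R p) (coord_subspace R S)
    = Some (covering_number S).
Proof.
move=> S0.
have spanC : translates_span (heisenberg_action R p) (coord_subspace R S)
    (covering_number S).
  have [T ST ->] := covering_numberP S S0.
  apply/translates_span_sumset; exists enum_val; rewrite -{}ST; congr sumset.
  apply/setP => x; apply/imsetP/idP => [[i _ ->]|xT]; first exact: enum_valP.
  by exists (enum_rank_in xT x); rewrite ?enum_rankK_in.
rewrite /diam_plus; case: boolp.pselect => [ex|]; last first.
  by case; exists (covering_number S); apply/boolp.asboolP.
case: ex_minnP => m /boolp.asboolP /translates_span_sumset[a aS] m_min.
congr Some; apply/eqP; rewrite eqn_leq m_min; last exact/boolp.asboolP.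
apply: leq_trans (covering_number_min S _ S0 aS) _.
by rewrite (leq_trans (leq_imset_card _ _)) // card_ord.
Qed.

Lemma card_sumset S T : (#|sumset S T| <= #|S| * #|T|)%N.
Proof.
by rewrite /sumset curry_imset2X -cardsX leq_imset_card.
Qed.

End Diameter.

Lemma ceil_div_le (m n q : nat) : (0 < n)%N -> (m <= n * q)%N ->
  ceil_div m n <= Posz q.
Proof.
move=> n0 mnq; rewrite /ceil_div ceil_le_int ler_pdivrMr ?ltr0n //.
by rewrite -natrM ler_nat mulnC.
Qed.

Theorem proposition6p1 (R : realType) (p : nat) (S : {set 'Z_p}) :
  prime p -> odd p -> S != set0 ->
  [/\ diam_plus (heisenberg_action R p) (coord_subspace R S)
        = Some (covering_number S),
      ceil_div (\dim {:CZp R p}) (\dim (coord_subspace R S)) = ceil_div p #|S|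
    & ceil_div p #|S| <= Posz (covering_number S)].
Proof.
move=> p_prime _ S0.
have cardZ : #|'Z_p| = p by rewrite card_ord Zp_cast ?prime_gt1.
split; first exact: diam_plus_coord_subspace.
  by rewrite dim_CZp dim_coord_subspace cardZ.
have [T ST ->] := covering_numberP S S0.
apply: ceil_div_le; first by rewrite card_gt0.
by rewrite -[X in (X <= _)%N]cardZ -cardsT -ST card_sumset.
Qed.
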